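(* Let $G=G[X,Y]$ be a bipartite graph on $n$ vertices with bipartition $(X,Y)$. Assume $|X|=r$, $|Y|=s$ and $r\leq s$. Then $$0\leq \kappa'(G)+\kappa'(G^{bc})\leq r$$ and $$0\leq \kappa'(G)\,\kappa'(G^{bc})\leq\left\lceil\frac{r}{2}\right\rceil\left\lfloor\frac{r}{2}\right\rfloor .$$ Moreover, the lower bound $0$ on the sum $\kappa'(G)+\kappa'(G^{bc})$ is sharp for all $n\geq 3$; the upper bound $r$ on the sum and the lower bound $0$ on the product $\kappa'(G)\kappa'(G^{bc})$ are sharp for all $n\geq 2$; and the upper bound $\lceil r/2\rceil\lfloor r/2\rfloor$ on the product is sharp for all $r\geq 4$.
   Context: All graphs are finite and simple. $G=G[X,Y]$ denotes a bipartite graph with a specified bipartition $(X,Y)$: every edge joins a vertex of $X$ to a vertex of $Y$. Its bipartite complementary graph $G^{bc}$ is the bipartite graph with $V(G^{bc})=V(G)$, the same bipartition $(X,Y)$, and $E(G^{bc})=\{xy: x\in X,\ y\in Y,\ xy\notin E(G)\}$. The edge-connectivity $\kappa'(H)$ of a graph $H$ is the minimum size of an edge set $F$ such that $H-F$ is disconnected. *)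

(* Defs.v *)
From mathcomp Require Import all_boot.

Set Implicit Arguments.
Unset Strict Implicit.
Unset Printing Implicit Defensive.

Record sgraph (V : finType) := SGraph {
  adj : rel V;
  adj_sym : symmetric adj;
  adj_irrefl : irreflexive adj
}.

Section EdgeConnectivity.
Variables (V : finType) (G : sgraph V).

Definition edges : {set {set V}} :=
  [set [set x; y] | x in V, y in adj G x].

Definition del_adj (F : {set {set V}}) : rel V :=
  [rel x y | adj G x y && ([set x; y] \notin F)].

Lemma del_adj_sym F : symmetric (del_adj F).
Proof. by move=> x y; rewrite /del_adj /= adj_sym setUC. Qed.

Lemma del_adj_irrefl F : irreflexive (del_adj F).
Proof. by move=> x; rewrite /del_adj /= adj_irrefl. Qed.

Definition del_edges (F : {set {set V}}) : sgraph V :=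
  SGraph (del_adj_sym F) (del_adj_irrefl F).

Definition disconnected : bool :=
  [exists x : V, exists y : V, ~~ connect (adj G) x y].

End EdgeConnectivity.

(* A graph with at least two vertices is disconnected by removing all its     *)
(* edges, so the default [edges G] of [arg min] is admissible. A graph with   *)
(* at most one vertex has no disconnecting edge set; [arg min] then returns   *)
(* [edges G], which is empty, giving the usual convention that the            *)
(* edge-connectivity of such a graph is 0.                                    *)
Definition edge_connectivity (V : finType) (G : sgraph V) : nat :=
  #|[arg min_(F < edges G | (F \subset edges G) && disconnected (del_edges G F))
       #|F| ]|.

Definition across (V : finType) (X Y : {set V}) : rel V :=
  [rel x y | (x \in X) && (y \in Y) || (x \in Y) && (y \in X)].

(* The bipartition is part of the data; either side may be empty. *)
Record bigraph (V : finType) := BiGraph {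
  bigraph_sgraph :> sgraph V;
  partX : {set V};
  partY : {set V};
  part_cover : partX :|: partY = [set: V];
  part_disjoint : [disjoint partX & partY];
  adj_across : forall x y, adj bigraph_sgraph x y -> across partX partY x y
}.

Section BipartiteComplement.
Variables (V : finType) (G : bigraph V).

Definition bc_adj : rel V :=
  [rel x y | across (partX G) (partY G) x y && ~~ adj G x y].

Lemma bc_adj_sym : symmetric bc_adj.
Proof.
move=> x y; rewrite /bc_adj /across /= [adj G y x]adj_sym orbC.
by congr ((_ || _) && _); rewrite andbC.
Qed.

Lemma bc_adj_irrefl : irreflexive bc_adj.
Proof.
move=> x; rewrite /bc_adj /across /= [X in _ || X]andbC orbb.
by case: (boolP (x \in partX G)) => //= /(disjointFr (part_disjoint G)) ->.
Qed.

Lemma bc_adj_across x y :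
  adj (SGraph bc_adj_sym bc_adj_irrefl) x y -> across (partX G) (partY G) x y.
Proof. by case/andP. Qed.

Definition bip_compl : bigraph V :=
  BiGraph (part_cover G) (part_disjoint G) bc_adj_across.

End BipartiteComplement.

(* Main.v *)
(* For the upper bounds, a vertex of Y has total degree r in G and its
   bipartite complement, and the edge-connectivity is at most the degree.

   The extremal graphs join x to y when (x + y) mod r < a, so the neighbourhood
   of each y is a cyclic interval of length a in Z/r and the bipartite
   complement has the same shape with r - a in place of a. Such a graph is
   a-edge-connected: a cut not splitting X contains all edges at some y, while
   a proper nonempty subset of Z/r splits at least a of the r cyclic intervals
   of length a >= 2, each of which contributes its own cut edge. The values a = r and
   a = ceil(r/2) settle the sharpness of the sum and of the product. *)

Require Import Defs.
From mathcomp Require Import all_boot.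
From mathcomp Require Import zify.

Set Implicit Arguments.
Unset Strict Implicit.
Unset Printing Implicit Defensive.

(** * Edge-connectivity: bounds from edge cuts and degrees *)

Lemma adj_edges (V : finType) (G : sgraph V) x y :
  adj G x y -> [set x; y] \in edges G.
Proof. by move=> xy; apply: imset2_f. Qed.

(** If the search for a minimum fails, [arg min] returns its default [edges G], so the bound
    survives without any disconnecting set. *)
Lemma edge_connectivity_le_edges (V : finType) (G : sgraph V) :
  edge_connectivity G <= #|edges G|.
Proof.
rewrite /edge_connectivity /arg_min /extremum.
case: pickP => //= F /andP[/andP[sFE _] _].
exact: subset_leq_card.
Qed.

Lemma disconnectedP (V : finType) (G : sgraph V) :
  reflect (exists x y, ~~ connect (adj G) x y) (disconnected G).
Proof. exact: 'exists_existsP. Qed.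

Lemma del_edges_isolated (V : finType) (G : sgraph V) (F : {set {set V}}) v w :
  v != w -> (forall x, adj G v x -> [set v; x] \in F) ->
  disconnected (del_edges G F).
Proof.
move=> neq_vw FG; apply/disconnectedP; exists v, w.
apply/connectP => -[[|x p] /= pth w_last]; first by rewrite w_last eqxx in neq_vw.
by case/andP: pth => /andP[/FG ->].
Qed.

Lemma edge_connectivity_min (V : finType) (G : sgraph V) (F : {set {set V}}) :
  F \subset edges G -> disconnected (del_edges G F) ->
  edge_connectivity G <= #|F|.
Proof.
move=> sFE disF.
pose P (A : {set {set V}}) :=
  (A \subset edges G) && disconnected (del_edges G A).
have PF : P F by rewrite /P sFE.
rewrite /edge_connectivity /arg_min /extremum.
case: pickP => [A /andP[_ /forall_inP]|no_min] /=; first by apply.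
(* A minimum taken from the admissible default [F] refutes an empty search. *)
have [A PA minA] := @arg_minnP _ F P (fun A => #|A|) PF.
by have /negP[] := no_min A; rewrite /= -/(P A) PA; apply/forall_inP.
Qed.

Lemma edge_connectivity_le_degree (V : finType) (G : sgraph V) (v : V) :
  1 < #|V| -> edge_connectivity G <= #|[set x | adj G v x]|.
Proof.
move=> V2; have [w neq_wv] : exists w, v != w.
  have := cardC1 v; case: (pickP (predC1 v)) => [w|/eq_card0 ->]; last by lia.
  by rewrite inE eq_sym; exists w.
pose star := [set [set v; x] | x in [set x | adj G v x]].
apply: leq_trans (leq_imset_card (fun x => [set v; x]) _).
apply: (@edge_connectivity_min _ _ star).
  by apply/subsetP => _ /imsetP[x vx ->]; rewrite inE in vx; apply: adj_edges.
apply: del_edges_isolated neq_wv _ => x vx.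
by apply/imsetP; exists x; rewrite ?inE.
Qed.

(** A disconnecting set contains every edge leaving the component of [u] that it creates; [p] will
    be membership in that component. *)
Lemma edge_connectivity_ge (V : finType) (G : sgraph V) (k : nat) :
  1 < #|V| ->
  (forall (p : pred V) (F : {set {set V}}) u v, p u -> ~~ p v ->
     (forall x y, adj G x y -> p x != p y -> [set x; y] \in F) -> k <= #|F|) ->
  k <= edge_connectivity G.
Proof.
move=> V2 cut_ge; rewrite /edge_connectivity; case: arg_minnP => [|F].
  rewrite subxx /=.
  have /card_gt1P[v [w [_ _ neq_vw]]] := V2.
  by apply: del_edges_isolated neq_vw _ => x; apply: adj_edges.
case/andP=> _ /disconnectedP[u [v not_uv]] _.
apply: (cut_ge (connect (adj (del_edges G F)) u) F u v) => // x y xy.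
apply: contraR => xyF.
have del_xy : adj (del_edges G F) x y by apply/andP.
have del_yx : adj (del_edges G F) y x by rewrite adj_sym.
apply/eqP; apply/idP/idP => [ux|uy].
  exact: connect_trans ux (connect1 del_xy).
exact: connect_trans uy (connect1 del_yx).
Qed.

(** * Upper bounds on the sum and the product *)

Lemma bip_compl_degree (V : finType) (G : bigraph V) y :
  y \in partY G ->
  #|[set x | adj G y x]| + #|[set x | adj (bip_compl G) y x]| = #|partX G|.
Proof.
move=> yY.
have yX : (y \in partX G) = false by apply: disjointFl yY; exact: part_disjoint.
rewrite -(cardsID [set x | adj G y x] (partX G)).
congr (_ + _); apply: eq_card => x.
  rewrite !inE andbC; case yx: (adj G y x) => //=.
  by have := adj_across yx; rewrite /across /= yX yY.
by rewrite !inE /= /bc_adj /= /across /= yX yY andbC.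
Qed.

(** Handles [r = 0] apart, where [Y] may be empty and the degree bound has no vertex to act on. *)
Lemma edge_connectivity_X0 (V : finType) (G : bigraph V) :
  #|partX G| = 0 -> edge_connectivity G = 0.
Proof.
move=> X0; apply/eqP; rewrite -leqn0.
apply: leq_trans (edge_connectivity_le_edges G) _.
rewrite leqn0 cards_eq0; apply/eqP/setP => A; rewrite inE.
apply/imset2P => -[x y _ /adj_across].
by rewrite /across /= !(card0_eq X0) andbF.
Qed.

Lemma edge_connectivity_sum_le (V : finType) (G : bigraph V) :
  #|partX G| <= #|partY G| ->
  edge_connectivity G + edge_connectivity (bip_compl G) <= #|partX G|.
Proof.
move=> leXY; case: (posnP #|partX G|) => [X0|X_gt0].
  by rewrite !edge_connectivity_X0.
have V2 : 1 < #|V|.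
  have := cardsUI (partX G) (partY G).
  rewrite part_cover cardsT.
  by rewrite (disjoint_setI0 (part_disjoint G)) cards0; lia.
have /card_gt0P[y yY] : 0 < #|partY G| by lia.
by rewrite -(bip_compl_degree yY) leq_add ?edge_connectivity_le_degree.
Qed.

(** From [4ab <= (a + b)^2 <= r^2]: the integer part of [r^2 / 4] is the product of the two halves
    of [r]. *)
Lemma leq_mul_halves a b r : a + b <= r -> a * b <= uphalf r * r./2.
Proof.
rewrite -leq_sqr => le_r; have := leq_trans (nat_AGM2 a b) le_r.
rewrite uphalf_half -[X in X ^ 2]odd_double_half -addnn.
by case: (odd r); nia.
Qed.

(** * Bipartite graphs given by a relation *)

Section BigraphOfRelation.
Variables (r s : nat) (e : 'I_r -> 'I_s -> bool).

Definition rel_adj (u v : 'I_r + 'I_s) : bool :=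
  match u, v with
  | inl x, inr y | inr y, inl x => e x y
  | _, _ => false
  end.

Lemma rel_adj_sym : symmetric rel_adj.
Proof. by move=> [x|y] [x'|y']. Qed.

Lemma rel_adj_irrefl : irreflexive rel_adj.
Proof. by case. Qed.

Definition left_part : {set 'I_r + 'I_s} := [set inl x | x in 'I_r].
Definition right_part : {set 'I_r + 'I_s} := [set inr y | y in 'I_s].

Lemma in_left_part u : (u \in left_part) = if u is inl _ then true else false.
Proof. by case: u => [x|y]; apply/imsetP; [exists x | case]. Qed.

Lemma in_right_part u : (u \in right_part) = if u is inr _ then true else false.
Proof. by case: u => [x|y]; apply/imsetP; [case | exists y]. Qed.

Lemma left_right_cover : left_part :|: right_part = setT.
Proof. by apply/setP => -[x|y]; rewrite !inE in_left_part in_right_part. Qed.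

Lemma left_right_disjoint : [disjoint left_part & right_part].
Proof.
rewrite disjoint_subset; apply/subsetP => -[x|y];
  by rewrite !inE in_left_part in_right_part.
Qed.

Lemma rel_adj_across u v :
  adj (SGraph rel_adj_sym rel_adj_irrefl) u v -> across left_part right_part u v.
Proof.
by case: u v => [x|y] [x'|y']; rewrite /across /= !in_left_part !in_right_part.
Qed.

Definition bigraph_of_rel : bigraph ('I_r + 'I_s)%type :=
  BiGraph left_right_cover left_right_disjoint rel_adj_across.

Lemma card_left_part : #|partX bigraph_of_rel| = r.
Proof. by rewrite card_imset ?card_ord // => x x' []. Qed.

Lemma card_right_part : #|partY bigraph_of_rel| = s.
Proof. by rewrite card_imset ?card_ord // => y y' []. Qed.

Lemma bip_compl_rel_adj x y :
  adj (bip_compl bigraph_of_rel) (inl x) (inr y) = ~~ e x y.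
Proof. by rewrite /= /bc_adj /across /= in_left_part in_right_part. Qed.

End BigraphOfRelation.

(** * Windows of a periodic sequence and shifts modulo [r] *)

(* The windows straddling the step from i + r to i + r + 1 start at the last
   a - 1 of the r positions. If all earlier windows were constant, q would be
   constant on i + 1, ..., i + r. *)
Lemma count_split_windows (q : nat -> bool) r a i :
  (forall k, q (k + r) = q k) -> q i != q i.+1 -> 1 < a <= r ->
  a <= count (fun k => ~~ all (fun t => q (k + t) == q k) (iota 0 a))
         (iota i.+1 r).
Proof.
move=> qr qi /andP[a_gt1 le_ar]; set split := fun k => _.
have splitS k t : t.+1 < a -> q (k + t) != q (k + t.+1) -> split k.
  move=> lt_ta; apply: contra => /allP h.
  by rewrite !(eqP (h _ _)) // mem_iota; lia.
have -> : r = (r - a).+1 + a.-1 by lia.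
rewrite iotaD count_cat -[leqLHS](prednK (ltnW a_gt1)) -add1n leq_add //.
  rewrite -has_count; apply/negPn/negP => /hasPn no_split.
  have step k : k.+1 < r -> q (i.+1 + k) = q (i.+1 + k.+1).
    move=> lt_kr; apply/eqP/negPn/negP => neq.
    (* Clamping the start at [r - a] keeps the window among the early ones, while it still covers
       positions [i.+1 + k] and [i.+1 + k.+1]. *)
    have := no_split (i.+1 + minn k (r - a)).
    rewrite mem_iota => /(_ ltac:(lia)) /negP; apply.
    apply: (splitS _ (k - minn k (r - a))); first by lia.
    by rewrite -!addnA addnS subnKC ?geq_minl.
  have const k : k < r -> q (i.+1 + k) = q i.+1.
    elim: k => [|k IHk] lt_kr; first by rewrite addn0.
    by rewrite -step // IHk // ltnW.
  case/eqP: qi; rewrite -(const r.-1); last by lia.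
  by rewrite -(qr i); congr q; lia.
rewrite -[leqLHS](size_iota (i.+1 + (r - a).+1)) leq_eqVlt eq_sym -all_count.
apply/orP; left; apply/allP => k; rewrite mem_iota => k_in.
apply: (splitS k (i + r - k)); first by lia.
by rewrite addnS !subnKC; [rewrite -addSn !qr | lia..].
Qed.

(* t - z mod r, avoiding truncated subtraction. *)
Definition modn_shift r z t := (t + (r - z %% r)) %% r.

Lemma modn_shiftK r z t : 0 < r -> (modn_shift r z t + z) %% r = t %% r.
Proof.
move=> r_gt0; rewrite /modn_shift modnDml -addnA -modnDmr -(modnDmr _ z).
by rewrite subnK ?modnn ?addn0 // ltnW ?ltn_pmod.
Qed.

Lemma modn_shift_inj r z t t' : t < r -> t' < r ->
  modn_shift r z t = modn_shift r z t' -> t = t'.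
Proof.
move=> lt_tr lt_t'r eq_sh; have r_gt0 : 0 < r by lia.
by have := modn_shiftK z t r_gt0; rewrite eq_sh modn_shiftK // !modn_small.
Qed.

(** * Edge cuts when neighbourhoods contain cyclic intervals *)

Section CyclicIntervalNeighbourhoods.
Variables (r s a c : nat) (G : sgraph ('I_r + 'I_s)%type).
Hypotheses (le_rs : r <= s) (r_gt0 : 0 < r) (le_ar : a <= r).
(** With [a = 1 < r] the interval edges alone form disjoint stars, a disconnected graph. The offset
    [c] below lets one argument serve both the interval graph and its complement. *)
Hypothesis a_gt1 : 1 < r -> 1 < a.
Hypothesis adj_interval :
  forall (x : 'I_r) (y : 'I_s), (x + y + c) %% r < a -> adj G (inl x) (inr y).

Let X k : 'I_r := Ordinal (ltn_pmod k r_gt0).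

(** Replaces two-element sets by pairs in the count of cut edges: the tags [inl] and [inr] recover
    the pair from the set. *)
Lemma card_cut_pairs (p : pred ('I_r + 'I_s)%type) (F : {set {set 'I_r + 'I_s}}) :
  (forall x y, adj G x y -> p x != p y -> [set x; y] \in F) ->
  #|[set xy : 'I_r * 'I_s
      | ((xy.1 + xy.2 + c) %% r < a) && (p (inl xy.1) != p (inr xy.2))]|
    <= #|F|.
Proof.
move=> cutF.
pose edge (xy : 'I_r * 'I_s) : {set 'I_r + 'I_s} := [set inl xy.1; inr xy.2].
rewrite -(card_imset _ (_ : injective edge)); last first.
  move=> [x y] [x' y'] eq_e; rewrite /edge /= in eq_e; congr (_, _).
    by have := set21 (inl x) (inr y); rewrite eq_e => /set2P[[]|].
  by have := set22 (inl x) (inr y); rewrite eq_e => /set2P[|[]].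
apply/subset_leq_card/subsetP => _ /imsetP[[x y] xy ->].
rewrite inE in xy; case/andP: xy => xy neq_p.
by apply: cutF => //; apply: adj_interval.
Qed.

Lemma cut_size_split_X (p : pred ('I_r + 'I_s)%type)
    (F : {set {set 'I_r + 'I_s}}) k :
  (forall x y, adj G x y -> p x != p y -> [set x; y] \in F) ->
  p (inl (X k)) != p (inl (X k.+1)) -> a <= #|F|.
Proof.
move=> /card_cut_pairs; set D := finset _ => leDF pk; apply: leq_trans leDF.
pose q i := p (inl (X i)).
have qE i j : i = j %[mod r] -> q i = q j.
  by move=> eq_ij; congr (p (inl _)); apply: val_inj.
have r_gt1 : 1 < r.
  case: (ltngtP r 1) => // [|r1]; first by lia.
  by case/eqP: pk; apply: qE; rewrite r1 !modn1.
have := @count_split_windows q r a k (fun i => qE _ _ (modnDr i r)) pk.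
rewrite a_gt1 // => /(_ le_ar) /leq_trans; apply.
set split := fun i => _.
(* [Y i] is [-(i + c)] modulo [r], chosen so that its interval is the window [i, ..., i + a - 1] of
   [X]. *)
have ltY i : modn_shift r (i + c) 0 < s.
  by apply: leq_trans le_rs; rewrite ltn_pmod.
pose Y i : 'I_s := Ordinal (ltY i).
(* Cut pairs are counted by their [Y]-coordinates, which differ for distinct split windows. *)
apply: leq_trans (leq_imset_card snd D).
rewrite -size_filter -(size_map Y).
have uniqY : uniq (map Y (filter split (iota k.+1 r))).
  rewrite map_inj_in_uniq ?filter_uniq ?iota_uniq // => i j.
  rewrite !mem_filter !mem_iota => /andP[_ i_in] /andP[_ j_in] [eqY].
  have eq_ij : i + c = j + c %[mod r].
    apply/eqP; rewrite -(eqn_modDl (modn_shift r (i + c) 0)).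
    by rewrite modn_shiftK // eqY modn_shiftK.
  move/eqP: eq_ij; rewrite eqn_modDr.
  rewrite -(subnKC (_ : k.+1 <= i)) -1?(subnKC (_ : k.+1 <= j)); [|lia..].
  by rewrite eqn_modDl !modn_small; [move=> /eqP -> | lia..].
rewrite -(card_uniqP uniqY); apply/subset_leq_card/subsetP => y.
case/mapP => i; rewrite mem_filter => /andP[split_i _] ->.
have inD t : t < a -> p (inl (X (i + t))) != p (inr (Y i)) -> Y i \in snd @: D.
  move=> lt_ta neq; apply/imsetP; exists (X (i + t), Y i) => //.
  rewrite inE neq andbT /= -addnA modnDml.
  have -> : i + t + (modn_shift r (i + c) 0 + c) =
            modn_shift r (i + c) 0 + (i + c) + t by lia.
  by rewrite -modnDml modn_shiftK // mod0n modn_small // (leq_trans lt_ta).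
(* [p] takes both values on a split window, so one of [X i] and [X (i + t)] lies across the cut from
   [Y i]. *)
have [t] := allPn split_i; rewrite mem_iota => /andP[_ lt_ta] neq.
have [eq_i|] := eqVneq (q (i + 0)) (p (inr (Y i))); last by apply: inD; lia.
by apply: (inD t) => //; rewrite -eq_i addn0.
Qed.

(** The [a] residues [t - (y + c)] with [t < a] are distinct because [a <= r]. *)
Lemma interval_degree (y : 'I_s) :
  a <= #|[set x : 'I_r | (x + y + c) %% r < a]|.
Proof.
have ltX (t : 'I_a) : modn_shift r (y + c) t < r by rewrite ltn_pmod.
have inj_X : injective (fun t => Ordinal (ltX t)).
  by move=> t t' [/modn_shift_inj eq_t]; apply/val_inj/eq_t;
    apply: leq_trans le_ar.
rewrite -[leqLHS]card_ord -cardsT -(card_imset _ inj_X).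
apply/subset_leq_card/subsetP => _ /imsetP[t _ ->].
by rewrite inE /= -addnA modn_shiftK // modn_small // (leq_trans _ le_ar).
Qed.

Lemma cut_size_const_X (p : pred ('I_r + 'I_s)%type)
    (F : {set {set 'I_r + 'I_s}}) y :
  (forall x y, adj G x y -> p x != p y -> [set x; y] \in F) ->
  (forall x, p (inl x) != p (inr y)) -> a <= #|F|.
Proof.
move=> /card_cut_pairs leDF neq_y; apply: leq_trans (interval_degree y) _.
apply: leq_trans leDF; rewrite -(card_imset _ (_ : injective (fun x => (x, y)))).
  apply/subset_leq_card/subsetP => _ /imsetP[x x_in ->].
  by rewrite inE in x_in; rewrite inE /= x_in neq_y.
by move=> x x' [].
Qed.

Lemma edge_connectivity_interval_ge : a <= edge_connectivity G.
Proof.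
apply: edge_connectivity_ge => [|p F u v pu pv cutF].
  by rewrite card_sum !card_ord; lia.
(* Either [p] changes between cyclically consecutive vertices of [X], or it is constant on [X]. *)
case: (boolP [forall k : 'I_r, p (inl (X k)) == p (inl (X k.+1))]); last first.
  by case/forallPn => k; apply: cut_size_split_X cutF.
move/forallP => const_X.
have p0 (x : 'I_r) : p (inl x) = p (inl (X 0)).
  case: x => k lt_kr.
  have -> : Ordinal lt_kr = X k by apply: val_inj; rewrite /= modn_small.
  elim: k lt_kr => // k IHk lt_kr.
  by have /eqP <- := const_X (Ordinal (ltnW lt_kr)); rewrite IHk // ltnW.
(* Both values of [p] occur, so the one missing on [X] is taken in [Y]. *)
have [y neq_y] : exists y, p (inl (X 0)) != p (inr y).
  move: pu pv; case: u v => [x|y] [x'|y']; rewrite ?p0.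
  - by move=> ->.
  - by move=> p0T /negPf py'; exists y'; rewrite p0T py'.
  - by move=> py /negPf p0F; exists y; rewrite py p0F.
  - move=> py /negPf py'; case p0E: (p (inl (X 0))).
      by exists y'; rewrite py'.
    by exists y; rewrite py.
by apply: (cut_size_const_X (y := y) cutF) => x; rewrite p0.
Qed.

End CyclicIntervalNeighbourhoods.

(** * The extremal graphs and the theorem *)

(** Translation by [r - a] carries the residues [a, ..., r - 1] to [0, ..., r - a - 1], so the
    complement of an interval is again an interval. *)
Lemma modn_complement r a z : 0 < r -> a <= r ->
  (z + (r - a)) %% r < r - a -> ~~ (z %% r < a).
Proof.
move=> r_gt0 le_ar; rewrite -modnDml; have := ltn_pmod z r_gt0.
move: (z %% r) => w lt_wr; apply: contraL => lt_wa.
by rewrite modn_small; lia.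
Qed.

(* For a = r this is the complete bipartite graph. *)
Definition interval_bigraph r s a : bigraph ('I_r + 'I_s)%type :=
  bigraph_of_rel (fun (x : 'I_r) (y : 'I_s) => (x + y) %% r < a).

(** The lower bounds [a] and [r - a] add up to the upper bound [r] on the sum, which forces both
    equalities. *)
Lemma interval_bigraph_connectivity r s a :
  r <= s -> a <= r -> (1 < r -> 1 < a) -> a = r \/ 1 < r - a ->
  edge_connectivity (interval_bigraph r s a) = a /\
  edge_connectivity (bip_compl (interval_bigraph r s a)) = r - a.
Proof.
move=> le_rs le_ar a_gt1 a_lt; set G := interval_bigraph r s a.
have le_sum : edge_connectivity G + edge_connectivity (bip_compl G) <= r.
  have := @edge_connectivity_sum_le _ G.
  by rewrite card_left_part card_right_part; apply.
have [r0|r_gt0] := posnP r; first by lia.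
have geG : a <= edge_connectivity G.
  by apply: (@edge_connectivity_interval_ge _ _ _ 0) => // x y; rewrite addn0.
have geGbc : r - a <= edge_connectivity (bip_compl G).
  case: a_lt => [->|a_lt]; first by rewrite subnn.
  apply: (@edge_connectivity_interval_ge _ _ _ (r - a)) => //.
    by rewrite leq_subr.
  by move=> x y xy; rewrite bip_compl_rel_adj; apply: modn_complement xy.
by lia.
Qed.

Lemma interval_bigraph_cards r s a :
  [/\ #|{: 'I_r + 'I_s}| = r + s, #|partX (interval_bigraph r s a)| = r
    & #|partY (interval_bigraph r s a)| = s].
Proof. by rewrite card_left_part card_right_part card_sum !card_ord. Qed.

Theorem theorem3p2 :
  (forall (V : finType) (G : bigraph V) (n r s : nat),
     #|V| = n -> #|partX G| = r -> #|partY G| = s -> r <= s ->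
     (0 <= edge_connectivity G + edge_connectivity (bip_compl G) <= r) /\
     (0 <= edge_connectivity G * edge_connectivity (bip_compl G)
        <= uphalf r * r./2)) /\
  (forall n r s : nat, r + s = n -> r <= s -> 3 <= n ->
     exists (V : finType) (G : bigraph V),
       [/\ #|V| = n, #|partX G| = r, #|partY G| = s &
           edge_connectivity G + edge_connectivity (bip_compl G) = 0]) /\
  (forall n r s : nat, r + s = n -> r <= s -> 2 <= n ->
     exists (V : finType) (G : bigraph V),
       [/\ #|V| = n, #|partX G| = r, #|partY G| = s &
           edge_connectivity G + edge_connectivity (bip_compl G) = r]) /\
  (forall n r s : nat, r + s = n -> r <= s -> 2 <= n ->
     exists (V : finType) (G : bigraph V),
       [/\ #|V| = n, #|partX G| = r, #|partY G| = s &
           edge_connectivity G * edge_connectivity (bip_compl G) = 0]) /\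
  (forall n r s : nat, r + s = n -> r <= s -> 4 <= r ->
     exists (V : finType) (G : bigraph V),
       [/\ #|V| = n, #|partX G| = r, #|partY G| = s &
           edge_connectivity G * edge_connectivity (bip_compl G)
             = uphalf r * r./2]).
Proof.
split=> [V G n r s _ <- <- le_rs|].
  have le_sum := edge_connectivity_sum_le le_rs.
  by rewrite !leq0n; split; last exact: leq_mul_halves.
split=> [n r s <- le_rs n_ge3|].
  have s_gt1 : 1 < s by lia.
  (* Joining [y0] to all of [X] and adding no other edge isolates [y1] in [G] and [y0] in the
     complement. *)
  pose y0 : 'I_s := Ordinal (ltnW s_gt1); pose y1 : 'I_s := Ordinal s_gt1.
  pose G := bigraph_of_rel (fun (_ : 'I_r) y => y == y0).
  exists ('I_r + 'I_s)%type, G.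
  have V_gt1 : 1 < #|{: 'I_r + 'I_s}| by rewrite card_sum !card_ord; lia.
  split; rewrite ?card_left_part ?card_right_part ?card_sum ?card_ord //.
  apply/eqP; rewrite addn_eq0 -!leqn0; apply/andP; split.
    apply: leq_trans (edge_connectivity_le_degree G (inr y1) V_gt1) _.
    by rewrite leqn0 cards_eq0; apply/eqP/setP => -[x|y]; rewrite !inE.
  apply: leq_trans (edge_connectivity_le_degree _ (inr y0) V_gt1) _.
  rewrite leqn0 cards_eq0; apply/eqP/setP => -[x|y]; rewrite !inE adj_sym.
    by rewrite bip_compl_rel_adj eqxx.
  by rewrite /= /bc_adj /across /= !in_left_part !in_right_part.
(* The complete bipartite graph and its edgeless complement attain both the sum [r] and the product
   0. *)
have complete r s : r <= s ->
    edge_connectivity (interval_bigraph r s r) = r /\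
    edge_connectivity (bip_compl (interval_bigraph r s r)) = 0.
  move=> le_rs; have := @interval_bigraph_connectivity r s r le_rs.
  by rewrite subnn; apply=> //; left.
split=> [n r s <- le_rs _|].
  exists ('I_r + 'I_s)%type, (interval_bigraph r s r).
  have [-> -> ->] := interval_bigraph_cards r s r.
  by have [-> ->] := complete r s le_rs; rewrite addn0.
split=> [n r s <- le_rs _|n r s <- le_rs r_ge4].
  exists ('I_r + 'I_s)%type, (interval_bigraph r s r).
  have [-> -> ->] := interval_bigraph_cards r s r.
  by have [-> ->] := complete r s le_rs; rewrite muln0.
exists ('I_r + 'I_s)%type, (interval_bigraph r s (uphalf r)).
have [-> -> ->] := interval_bigraph_cards r s (uphalf r).
(* Both halves of [r] are at least 2 because [r >= 4]. *)
have [] := @interval_bigraph_connectivity r s (uphalf r) le_rs; [lia..|].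
by move=> -> ->; split=> //; congr (_ * _); lia.
Qed.
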